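(* Let $(\mathscr{C},*,\omega)$ be a hermitian category with form parameter $(\varepsilon,\Lambda)$. Assume that every object of $\mathscr{C}$ is a direct sum of finitely many objects with local endomorphism ring (or, alternatively, that the endomorphism ring of every object of $\mathscr{C}$ is semiperfect). Then unimodular $(\varepsilon,\Lambda)$-quadratic forms over $\mathscr{C}$ cancel from orthogonal sums: if $(P,[\beta])$, $(Q_1,[\gamma_1])$, $(Q_2,[\gamma_2])$ are $(\varepsilon,\Lambda)$-quadratic spaces over $\mathscr{C}$ with $(P,[\beta])$ unimodular and $(P,[\beta])\perp(Q_1,[\gamma_1])\cong(P,[\beta])\perp(Q_2,[\gamma_2])$, then $(Q_1,[\gamma_1])\cong(Q_2,[\gamma_2])$.
   Context: A hermitian category is a triple $(\mathscr{C},*,\omega)$ where $\mathscr{C}$ is an additive category, $*:\mathscr{C}\to\mathscr{C}$ is a contravariant additive functor, and $\omega=\{\omega_M:M\to M^{**}\}$ is a natural isomorphism from $\mathrm{id}_{\mathscr C}$ to $**$ with $\omega_M^*\circ\omega_{M^*}=\mathrm{id}_{M^*}$ for every $M$. A form parameter is a pair $(\varepsilon,\Lambda)$ with $\varepsilon\in\{\pm1\}$ and $\Lambda=\{\Lambda_M\}_{M\in\mathscr{C}}$ a family of subgroups $\Lambda_M\subseteq\mathrm{Hom}(M,M^* )$ such that $\{f-\varepsilon f^*\omega_M: f\in\mathrm{Hom}(M,M^* )\}\subseteq\Lambda_M\subseteq\{f\in\mathrm{Hom}(M,M^* ): f=-\varepsilon f^*\omega_M\}$ and $g^*\Lambda_Ng\subseteq\Lambda_M$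 for all $g\in\mathrm{Hom}(M,N)$. An $(\varepsilon,\Lambda)$-quadratic space is a pair $(M,[\beta])$ with $M\in\mathscr{C}$ and $[\beta]\in\mathrm{Hom}(M,M^* )/\Lambda_M$; it is unimodular if $\beta+\varepsilon\beta^*\omega_M:M\to M^*$ is an isomorphism. An isometry $(M,[\beta])\to(N,[\gamma])$ is an isomorphism $f:M\to N$ with $[f^*\gamma f]=[\beta]$; $\cong$ means that an isometry exists. The orthogonal sum is $(M,[\beta])\perp(N,[\gamma])=(M\oplus N,[\beta\oplus\gamma])$ (identifying $(M\oplus N)^*$ with $M^*\oplus N^*$). A ring is semiperfect if it is semilocal and idempotents lift modulo its Jacobson radical. *)

(* Defs.v *)
From HB Require Import structures.
From mathcomp Require Import all_boot all_algebra.
From mathcomp Require Import boolp classical_sets.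

Set Implicit Arguments.
Unset Strict Implicit.
Unset Printing Implicit Defensive.

Import GRing.Theory.
Local Open Scope ring_scope.
Local Open Scope quotient_scope.

(** Noncommutative rings.  All notions are stated over [pzRingType]: the
    endomorphism ring of a zero object is the zero ring. *)

Definition left_ideal (R : pzRingType) (I : set R) : Prop :=
  [/\ I 0, (forall x y, I x -> I y -> I (x + y))
    & (forall r x, I x -> I (r * x))].

Definition maximal_left_ideal (R : pzRingType) (I : set R) : Prop :=
  [/\ left_ideal I, I <> setT
    & forall K : set R, left_ideal K -> (I `<=` K)%classic ->
        K = I \/ K = setT].

Definition local_ring (R : pzRingType) : Prop :=
  exists! I : set R, maximal_left_ideal I.

Definition jacobson (R : pzRingType) : {pred R} :=
  fun x => `[< forall I : set R, maximal_left_ideal I -> I x >].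

Section JacobsonQuotient.
Variable R : pzRingType.

Lemma jacobsonP (x : R) :
  reflect (forall I : set R, maximal_left_ideal I -> I x)
          (x \in @jacobson R).
Proof. exact: asboolP. Qed.

Lemma left_idealN (I : set R) x : left_ideal I -> I x -> I (- x).
Proof. by case=> _ _ IM Ix; rewrite -mulN1r; apply: IM. Qed.

Lemma jacobson_zmod_closed : zmod_closed (@jacobson R).
Proof.
split=> [|x y /jacobsonP Jx /jacobsonP Jy]; apply/jacobsonP => I maxI.
  by case: maxI => -[].
have [lI _ _] := maxI; have [_ ID _] := lI.
by apply: ID; [apply: Jx | apply: left_idealN => //; apply: Jy].
Qed.

HB.instance Definition _ :=
  GRing.isZmodClosed.Build R (@jacobson R) jacobson_zmod_closed.

Lemma jacobsonMl (r x : R) : x \in @jacobson R -> r * x \in @jacobson R.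
Proof.
move=> /jacobsonP Jx; apply/jacobsonP => I maxI.
by have [[_ _ IM] _ _] := maxI; apply: IM; apply: Jx.
Qed.

Lemma jacobsonMr (x r : R) : x \in @jacobson R -> x * r \in @jacobson R.
Proof.
move=> /jacobsonP Jx; apply/jacobsonP => I maxI.
have [lI _ Imax] := maxI; have [I0 ID IM] := lI.
have [Ir|nIr] := pselect (I r); first exact: IM.
suff /Jx : maximal_left_ideal [set a | I (a * r)]%classic by [].
split=> [|/(congr1 (fun A : set R => A 1)) /=|K lK sub].
- split=> [|a b Ia Ib|a b Ib] /=; first by rewrite mul0r.
    by rewrite mulrDl; apply: ID.
  by rewrite -mulrA; apply: IM.
- by rewrite mul1r => E; apply: nIr; rewrite E.
have [K0 KD KM] := lK.
have [KI|] := pselect (forall b, K b -> I (b * r)).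
  by left; apply/seteqP; split.
move=> /existsNP [b /not_implyP [Kb nIb]]; right.
apply/seteqP; split=> // a _.
pose L : set R := [set y | exists m c, I m /\ y = m + c * (b * r)]%classic.
have lL : left_ideal L.
  split=> [|_ _ [m [c [Im ->]]] [n [d [In ->]]]|s _ [m [c [Im ->]]]].
  - by exists 0, 0; rewrite mul0r addr0.
  - by exists (m + n), (c + d); split; [apply: ID | rewrite mulrDl addrACA].
  by exists (s * m), (s * c); split; [apply: IM | rewrite mulrDr mulrA].
have sIL : (I `<=` L)%classic.
  by move=> m Im; exists m, 0; rewrite mul0r addr0.
have Lb : L (b * r) by exists 0, 1; rewrite mul1r add0r.
have [LI|LT] := Imax L lL sIL; first by move: Lb; rewrite LI.
have [m [c [Im ar]]] : L (a * r) by rewrite LT.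
have Kd : K (a - c * b).
  by apply: sub; rewrite /= mulrBl ar -mulrA addrK.
by rewrite -[a](subrK (c * b)); apply: KD => //; apply: KM.
Qed.

Definition jacobson_quot : Type := {ideal_quot (@jacobson R)}.

HB.instance Definition _ := GRing.Zmodule.on jacobson_quot.
HB.instance Definition _ := EqQuotient.on jacobson_quot.

Definition jq (x : R) : jacobson_quot := \pi_jacobson_quot x.

Lemma jqP (x y : R) : reflect (jq x = jq y) (x - y \in @jacobson R).
Proof. by rewrite Quotient.idealrBE; apply: eqP. Qed.

Lemma jq_surj (u : jacobson_quot) : exists x, u = jq x.
Proof. by exists (repr u); rewrite /jq reprK. Qed.

Definition jq_one : jacobson_quot := jq 1.
Definition jq_mul (u v : jacobson_quot) : jacobson_quot := jq (repr u * repr v).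

Lemma jq_mulE x y : jq_mul (jq x) (jq y) = jq (x * y).
Proof.
apply/jqP.
have dx : repr (jq x) - x \in @jacobson R by apply/jqP; rewrite /jq reprK.
have dy : repr (jq y) - y \in @jacobson R by apply/jqP; rewrite /jq reprK.
set x' := repr (jq x) in dx *; set y' := repr (jq y) in dy *.
rewrite (_ : _ - _ = (x' - x) * y' + x * (y' - y)).
  by apply: rpredD; [apply: jacobsonMr | apply: jacobsonMl].
by rewrite mulrBl mulrBr addrA subrK.
Qed.

Lemma jqD x y : jq (x + y) = jq x + jq y.
Proof. exact: (raddfD (\pi_({ideal_quot (@jacobson R)}))). Qed.

Lemma jq_mulA : associative jq_mul.
Proof.
move=> u v w; have [x ->] := jq_surj u; have [y ->] := jq_surj v.
have [z ->] := jq_surj w.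
by rewrite (jq_mulE y z) (jq_mulE x y) (jq_mulE x) jq_mulE mulrA.
Qed.

Lemma jq_mul1r : left_id jq_one jq_mul.
Proof. by move=> u; have [x ->] := jq_surj u; rewrite jq_mulE mul1r. Qed.

Lemma jq_mulr1 : right_id jq_one jq_mul.
Proof. by move=> u; have [x ->] := jq_surj u; rewrite jq_mulE mulr1. Qed.

Lemma jq_mulDl : left_distributive jq_mul +%R.
Proof.
move=> u v w; have [x ->] := jq_surj u; have [y ->] := jq_surj v.
have [z ->] := jq_surj w.
by rewrite -jqD (jq_mulE (x + y) z) (jq_mulE x z) (jq_mulE y z) mulrDl jqD.
Qed.

Lemma jq_mulDr : right_distributive jq_mul +%R.
Proof.
move=> u v w; have [x ->] := jq_surj u; have [y ->] := jq_surj v.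
have [z ->] := jq_surj w.
by rewrite -jqD (jq_mulE x (y + z)) (jq_mulE x y) (jq_mulE x z) mulrDr jqD.
Qed.

HB.instance Definition _ := GRing.Zmodule_isPzRing.Build jacobson_quot
  jq_mulA jq_mul1r jq_mulr1 jq_mulDl jq_mulDr.

Lemma jq_is_zmod_morphism : zmod_morphism jq.
Proof. exact: (raddfB (\pi_({ideal_quot (@jacobson R)}))). Qed.

HB.instance Definition _ :=
  GRing.isZmodMorphism.Build R jacobson_quot jq jq_is_zmod_morphism.

Lemma jq_is_monoid_morphism : monoid_morphism jq.
Proof. by split=> // x y; rewrite -jq_mulE. Qed.

HB.instance Definition _ :=
  GRing.isMonoidMorphism.Build R jacobson_quot jq jq_is_monoid_morphism.

End JacobsonQuotient.

(** Semisimple as a left module over itself: every submodule is a direct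
    summand. *)
Definition semisimple_ring (R : pzRingType) : Prop :=
  forall I : set R, left_ideal I ->
    exists K : set R,
      [/\ left_ideal K, (forall x, I x -> K x -> x = 0)
        & forall x, exists y z, [/\ I y, K z & x = y + z]].

Definition semilocal_ring (R : pzRingType) : Prop :=
  semisimple_ring (jacobson_quot R).

Definition idempotents_lift (R : pzRingType) : Prop :=
  forall u : jacobson_quot R, u * u = u ->
    exists e : R, e * e = e /\ jq e = u.

Definition semiperfect_ring (R : pzRingType) : Prop :=
  semilocal_ring R /\ idempotents_lift R.

(** Additive categories, with chosen zero object and binary biproducts. *)

Record additiveCategory := AdditiveCategory {
  ob :> Type;
  hom : ob -> ob -> zmodType;
  idm : forall M, hom M M;
  comp : forall M N P, hom N P -> hom M N -> hom M P;
  compA : forall M N P Q (h : hom P Q) (g : hom N P) (f : hom M N),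
    comp h (comp g f) = comp (comp h g) f;
  comp1m : forall M N (f : hom M N), comp (idm N) f = f;
  compm1 : forall M N (f : hom M N), comp f (idm M) = f;
  compDl : forall M N P (g h : hom N P) (f : hom M N),
    comp (g + h) f = comp g f + comp h f;
  compDr : forall M N P (g : hom N P) (f h : hom M N),
    comp g (f + h) = comp g f + comp g h;
  zero_ob : ob;
  zero_ob_initial : forall M (f : hom zero_ob M), f = 0;
  zero_ob_terminal : forall M (f : hom M zero_ob), f = 0;
  biprod : ob -> ob -> ob;
  in1 : forall M N, hom M (biprod M N);
  in2 : forall M N, hom N (biprod M N);
  pr1 : forall M N, hom (biprod M N) M;
  pr2 : forall M N, hom (biprod M N) N;
  pr1_in1 : forall M N, comp (pr1 M N) (in1 M N) = idm M;
  pr2_in2 : forall M N, comp (pr2 M N) (in2 M N) = idm N;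
  pr1_in2 : forall M N, comp (pr1 M N) (in2 M N) = 0;
  pr2_in1 : forall M N, comp (pr2 M N) (in1 M N) = 0;
  biprod_id : forall M N,
    comp (in1 M N) (pr1 M N) + comp (in2 M N) (pr2 M N) = idm (biprod M N)
}.

Arguments hom {C} M N : rename.
Arguments idm {C} M : rename.
Arguments comp {C M N P} g f : rename.
Arguments zero_ob {C} : rename.
Arguments biprod {C} M N : rename.
Arguments in1 {C} M N : rename.
Arguments in2 {C} M N : rename.
Arguments pr1 {C} M N : rename.
Arguments pr2 {C} M N : rename.

Notation "g '\oc' f" := (comp g f)
  (at level 40, left associativity, format "g  '\oc'  f") : ring_scope.

Section AdditiveCategoryDefs.
Variable C : additiveCategory.
Implicit Types M N : C.

Definition is_iso M N (f : hom M N) : Prop :=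
  exists g : hom N M, g \oc f = idm M /\ f \oc g = idm N.

Definition endo M : Type := hom M M.

HB.instance Definition _ M := GRing.Zmodule.on (endo M).
HB.instance Definition _ M := GRing.Zmodule_isPzRing.Build (endo M)
  (@compA C M M M M) (@comp1m C M M) (@compm1 C M M)
  (fun f g h => @compDl C M M M f g h) (@compDr C M M M).

Definition is_direct_sum M n (N : 'I_n -> C) : Prop :=
  exists (i : forall k, hom (N k) M) (p : forall k, hom M (N k)),
    [/\ forall k, p k \oc i k = idm (N k),
        forall k l, k != l -> p l \oc i k = 0
      & \sum_(k < n) i k \oc p k = idm M].

End AdditiveCategoryDefs.

Record hermitianCategory := HermitianCategory {
  herm_cat :> additiveCategory;
  dual : herm_cat -> herm_cat;
  dualm : forall M N : herm_cat, hom M N -> hom (dual N) (dual M);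
  dualm_id : forall M, dualm (idm M) = idm (dual M);
  dualm_comp : forall M N P (g : hom N P) (f : hom M N),
    dualm (g \oc f) = dualm f \oc dualm g;
  dualmD : forall M N (f g : hom M N), dualm (f + g) = dualm f + dualm g;
  omega : forall M, hom M (dual (dual M));
  omega_natural : forall M N (f : hom M N),
    omega N \oc f = dualm (dualm f) \oc omega M;
  omega_iso : forall M, is_iso (omega M);
  omega_dual : forall M, dualm (omega M) \oc omega (dual M) = idm (dual M)
}.

Arguments dual {C} M : rename.
Arguments dualm {C M N} f : rename.
Arguments omega {C} M : rename.

Record formParameter (C : hermitianCategory) := FormParameter {
  eps : int;
  epsP : eps = 1 \/ eps = -1;
  Lam : forall M : C, zmodClosed (hom M (dual M));
  Lam_min : forall (M : C) (f : hom M (dual M)),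
    f - (dualm f \oc omega M) *~ eps \in Lam M;
  Lam_max : forall (M : C) (f : hom M (dual M)),
    f \in Lam M -> f = - ((dualm f \oc omega M) *~ eps);
  Lam_pull : forall (M N : C) (g : hom M N) (f : hom N (dual N)),
    f \in Lam N -> dualm g \oc f \oc g \in Lam M
}.

Section QuadraticSpaces.
Variables (C : hermitianCategory) (L : formParameter C).
Implicit Types M N : C.

(** The group Hom(M, M^* ) / Lambda_M. *)
Definition form_class M : Type := {ideal_quot (Lam L M)}.

HB.instance Definition _ M := GRing.Zmodule.on (form_class M).
HB.instance Definition _ M := EqQuotient.on (form_class M).

Definition cls M (b : hom M (dual M)) : form_class M := \pi_(form_class M) b.

Lemma clsP M (b c : hom M (dual M)) :
  reflect (cls b = cls c) (b - c \in Lam L M).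
Proof. by rewrite Quotient.idealrBE; apply: eqP. Qed.

Record quadratic_space :=
  QuadraticSpace { qs_ob : C; qs_form : form_class qs_ob }.

(** The operations below are defined on a representative of the class; the
    lemmas [*_cls] show that they do not depend on it. *)

Definition hermitianization M (b : hom M (dual M)) : hom M (dual M) :=
  b + (dualm b \oc omega M) *~ eps L.

Definition unimodular (X : quadratic_space) : Prop :=
  is_iso (hermitianization (repr (qs_form X))).

Definition pull_form M N (f : hom M N) (c : form_class N) : form_class M :=
  cls (dualm f \oc repr c \oc f).

Definition isometry (X Y : quadratic_space) (f : hom (qs_ob X) (qs_ob Y)) : Prop :=
  is_iso f /\ pull_form f (qs_form Y) = qs_form X.

Definition isometric (X Y : quadratic_space) : Prop :=
  exists f : hom (qs_ob X) (qs_ob Y), isometry f.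

(** [b (+) c], transported along the identification of the dual of [M (+) N]
    with [dual M (+) dual N], whose injections are the duals of the
    projections of [M (+) N]. *)
Definition form_sum M N (b : hom M (dual M)) (c : hom N (dual N)) :
    hom (biprod M N) (dual (biprod M N)) :=
  dualm (pr1 M N) \oc b \oc pr1 M N + dualm (pr2 M N) \oc c \oc pr2 M N.

Definition orth_sum (X Y : quadratic_space) : quadratic_space :=
  @QuadraticSpace (biprod (qs_ob X) (qs_ob Y))
    (cls (form_sum (repr (qs_form X)) (repr (qs_form Y)))).

Lemma cls_repr M (c : form_class M) : cls (repr c) = c.
Proof. exact: reprK. Qed.

Lemma comp0m M N (P : C) (f : hom M N) : (0 : hom N P) \oc f = 0.
Proof. by apply: (addIr (0 \oc f)); rewrite -compDl !add0r. Qed.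

Lemma compm0 M N (P : C) (g : hom N P) : g \oc (0 : hom M N) = 0.
Proof. by apply: (addIr (g \oc 0)); rewrite -compDr !add0r. Qed.

Lemma compNm M N (P : C) (g : hom N P) (f : hom M N) : (- g) \oc f = - (g \oc f).
Proof. by apply/eqP; rewrite -addr_eq0 -compDl addNr comp0m. Qed.

Lemma compmN M N (P : C) (g : hom N P) (f : hom M N) : g \oc (- f) = - (g \oc f).
Proof. by apply/eqP; rewrite -addr_eq0 -compDr addNr compm0. Qed.

Lemma dualm0 M N : dualm (0 : hom M N) = 0.
Proof. by apply: (addIr (dualm 0)); rewrite -dualmD !add0r. Qed.

Lemma dualmN M N (f : hom M N) : dualm (- f) = - dualm f.
Proof. by apply/eqP; rewrite -addr_eq0 -dualmD addNr dualm0. Qed.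

Lemma pull_form_cls M N (f : hom M N) (c : hom N (dual N)) :
  pull_form f (cls c) = cls (dualm f \oc c \oc f).
Proof.
apply/clsP; rewrite -compNm -compmN -compDl -compDr.
by apply: Lam_pull; apply/clsP; rewrite cls_repr.
Qed.

Lemma hermitianization_cls M (b c : hom M (dual M)) :
  cls b = cls c -> hermitianization b = hermitianization c.
Proof.
move=> /clsP /Lam_max E; apply/eqP; rewrite -subr_eq0 opprD addrACA -mulrzBl.
by rewrite -compNm -compDl -dualmN -dualmD [X in X + _]E addNr.
Qed.

Lemma unimodular_cls M (b : hom M (dual M)) :
  unimodular (QuadraticSpace (cls b)) = is_iso (hermitianization b).
Proof. by rewrite /unimodular (hermitianization_cls (cls_repr (cls b))). Qed.

Lemma orth_sum_cls M N (b : hom M (dual M)) (c : hom N (dual N)) :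
  orth_sum (QuadraticSpace (cls b)) (QuadraticSpace (cls c))
  = QuadraticSpace (cls (form_sum b c)).
Proof.
rewrite /orth_sum /=; congr QuadraticSpace; apply/clsP.
rewrite opprD addrACA -!(compNm (_ \oc _)) -!compmN -!compDl -!compDr.
by apply: rpredD; apply: Lam_pull; apply/clsP; rewrite cls_repr.
Qed.

End QuadraticSpaces.

(* Main.v *)
From mathcomp Require Import all_boot all_algebra.
From mathcomp Require Import boolp classical_sets.
Require Import Defs.

Set Implicit Arguments.
Unset Strict Implicit.
Unset Printing Implicit Defensive.

Import GRing.Theory.
Local Open Scope ring_scope.

(** Cancellation is reduced to cancelling a hyperbolic plane over one local
    idempotent, where an explicit exchange argument works in every residue
    characteristic.

    Write [P ⟂ Q1 ≅ P ⟂ Q2] as two embeddings of [P] into one space [V], with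
    orthogonal complements [Q1] and [Q2].  Adding a copy of [P] with the
    opposite form turns each embedding [i] into a totally isotropic one,
    [x = (i, 1)], which has an isotropic dual partner [y]; the complement of
    the pair [(x, y)] in [V ⟂ -P] is still the complement of [i] in [V]
    ([hyperbolic_cover]).  So it suffices to compare the complements of two
    hyperbolic pairs indexed by the same object.

    If two hyperbolic pairs [(x, y)] and [(x', y)] share a member, the shear
    [v ↦ v - y k' h(x', v)] maps one complement isometrically onto the other,
    because [y] is isotropic and orthogonal to the complement
    ([perp_exchange]).  Over a local idempotent, any two hyperbolic pairs are
    joined by a chain of such exchanges: if one of [h(x', y)], [h(x, y')],
    [h(y, y')] is invertible the chain is immediate, and otherwise a correction
    of [x + x'] by a multiple of [y] is isotropic and forms a hyperbolic pair
    with both [y] and [y'] ([local_cancels]).  An orthogonal sum of two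
    idempotents is handled by treating one summand first and continuing in the
    complement so obtained ([cancels_add]).

    Either hypothesis makes [1] in the endomorphism ring of [P] a finite sum of
    orthogonal local idempotents: immediately so for direct sums of objects with
    local endomorphism rings, and by lifting idempotents from the semisimple
    quotient, under a chain condition, in the semiperfect case
    ([semiperfect_local_dec]).

    Idempotents need not split in the category.  For this reason summands of an
    object are represented by idempotents throughout, and orthogonal
    complements by the families of morphisms into [V] that factor through them
    ([subfunctor]). *)

(** * Left ideals and the Jacobson radical *)

Section LeftIdeals.
Variable R : pzRingType.
Implicit Types (a b c e f g r x y : R) (I K : set R).

Definition principal a : set R := [set x | exists r, x = r * a]%classic.

Lemma principal_left_ideal a : left_ideal (principal a).
Proof.
split=> [|_ _ [r ->] [s ->]|s _ [r ->]]; first by exists 0; rewrite mul0r.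
  by exists (r + s); rewrite mulrDl.
by exists (s * r); rewrite mulrA.
Qed.

Lemma left_ideal_bigcup (F : set (set R)) :
  (F !=set0)%classic -> (forall I, F I -> left_ideal I) ->
  total_on F subset -> left_ideal (\bigcup_(I in F) I)%classic.
Proof.
move=> [I0 FI0] lF totF; split=> [|x y [I FI Ix] [K FK Ky]|r x [I FI Ix]].
- by exists I0 => //; case: (lF _ FI0).
- have [sIK|sKI] := totF _ _ FI FK.
    by exists K => //; case: (lF _ FK) => _ KD _; apply: KD => //; apply: sIK.
  by exists I => //; case: (lF _ FI) => _ ID _; apply: ID => //; apply: sKI.
by exists I => //; case: (lF _ FI) => _ _ IM; apply: IM.
Qed.

(** Zorn's lemma on proper left ideals.  The empty set is added to the poset only
    to give the empty chain an upper bound. *)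
Lemma maximal_left_ideal_above I :
  left_ideal I -> ~ I 1 ->
  exists2 K, maximal_left_ideal K & (I `<=` K)%classic.
Proof.
move=> lI I1.
pose P : set (set R) := [set A | A = set0 \/
  [/\ left_ideal A, (I `<=` A)%classic & ~ A 1]]%classic.
have [|A [PA maxA]] := @Zorn_bigcup _ P.
  move=> F sFP totF.
  pose G : set (set R) := [set A | F A /\ A <> set0]%classic.
  have -> : (\bigcup_(A in F) A = \bigcup_(A in G) A)%classic.
    apply/seteqP; split=> x [A FA Ax]; exists A => //; last by case: FA.
    by split=> // A0; move: Ax; rewrite A0.
  have GP A : G A -> [/\ left_ideal A, (I `<=` A)%classic & ~ A 1].
    by move=> [/sFP[]].
  have [[A GA]|G0] := pselect (G !=set0)%classic; last first.
    by left; apply/seteqP; split=> // x [A GA Ax]; case: G0; exists A.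
  right; split=> [|x Ix|[B /GP[_ _ B1] /B1]//].
    apply: left_ideal_bigcup; first by exists A.
      by move=> B /GP[].
    by move=> B B' [FB _] [FB' _]; apply: totF.
  by exists A => //; case: (GP _ GA) => _ sIA _; apply: sIA.
have [I0 _ _] := lI.
case: PA => [A0|[lA sIA A1]].
  case: (maxA I); last by right; split.
  by rewrite A0 properEneq; split=> //; apply/eqP => E; rewrite -E in I0.
exists A => //; split=> // [AT|K lK sAK].
  by apply: A1; rewrite AT.
have [K1|K1] := pselect (K 1).
  right; apply/seteqP; split=> // x _; case: lK => _ _ KM.
  by rewrite -[x]mulr1; apply: KM.
left; apply: contrapT => nKA; apply: (maxA K).
  by rewrite properEneq; split=> //; apply/eqP => E; apply: nKA.
by right; split=> // x /sIA /sAK.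
Qed.

(** An element without left inverse generates a proper left ideal. *)
Lemma left_inverse_or_maximal a :
  (exists c, c * a = 1) \/ exists2 K, maximal_left_ideal K & K a.
Proof.
have [[c E]|na] := pselect (principal a 1); first by left; exists c.
right; have [K mK sK] := maximal_left_ideal_above (principal_left_ideal a) na.
by exists K => //; apply: sK; exists 1; rewrite mul1r.
Qed.

Lemma maximal_proper K : maximal_left_ideal K -> ~ K 1.
Proof.
move=> [[_ _ KM] KT _] K1; apply: KT; apply/seteqP; split=> // x _.
by rewrite -[x]mulr1; apply: KM.
Qed.

Lemma jacobson_left_inverse x :
  x \in @jacobson R -> exists y, y * (1 - x) = 1.
Proof.
move=> /jacobsonP Jx.
have [//|[K mK Kx]] := left_inverse_or_maximal (1 - x).
case: (maximal_proper mK); have [[_ KD _] _ _] := mK.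
by rewrite -(subrK x 1); apply: KD => //; apply: Jx.
Qed.

(** A left inverse [y] of [1 - x] is [1 + y x], hence left invertible itself, and
    so a two-sided inverse. *)
Lemma jacobson_inverse x :
  x \in @jacobson R -> exists y, y * (1 - x) = 1 /\ (1 - x) * y = 1.
Proof.
move=> Jx; have [y yx] := jacobson_left_inverse Jx.
have Jyx : - (y * x) \in @jacobson R by rewrite rpredN; apply: jacobsonMl.
have [z zy] := jacobson_left_inverse Jyx.
have Ey : 1 - - (y * x) = y.
  by move: yx; rewrite opprK mulrBr mulr1 => <-; rewrite subrK.
rewrite Ey in zy; exists y; split=> //.
suff -> : 1 - x = z by [].
by rewrite -[LHS]mul1r -{1}zy -mulrA yx mulr1.
Qed.

Lemma jq_eq0 x : jq x = 0 <-> x \in @jacobson R.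
Proof.
split=> [E|Jx]; first by rewrite -(subr0 x); apply/jqP; rewrite E raddf0.
by rewrite -(raddf0 (@jq R)); apply/jqP; rewrite subr0.
Qed.

Lemma jacobson_idempotent e : e * e = e -> jq e = 0 -> e = 0.
Proof.
move=> ee /jq_eq0 /jacobson_inverse [y [_ E]].
by rewrite -[e]mulr1 -E mulrA mulrBr mulr1 ee subrr mul0r.
Qed.

(** * Local idempotents *)

(** For [a] in the corner ring [eRe] this is invertibility there: an inverse [c]
    may be replaced by [e * c * e]. *)
Definition corner_unit e a := exists c, c * a = e /\ a * c = e.

(** The corner ring [eRe] is local, in the elementwise form that is used below.
    Zero is included, which spares case distinctions. *)
Definition local_idem e :=
  e * e = e /\
  forall a b, e * a * e = a -> e * b * e = b -> a + b = e ->
    corner_unit e a \/ corner_unit e b.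

Inductive local_dec : R -> Prop :=
| Local_dec_one e : local_idem e -> local_dec e
| Local_dec_add e f : e * f = 0 -> f * e = 0 ->
    local_dec e -> local_dec f -> local_dec (e + f).

Lemma local_dec_idem e : local_dec e -> e * e = e.
Proof.
elim=> [{}e [] //|{}e f ef fe _ ee _ ff].
by rewrite mulrDl !mulrDr ee ff ef fe addr0 add0r.
Qed.

Lemma cornerK e a : e * e = e -> e * a * e = a -> e * a = a /\ a * e = a.
Proof.
by move=> ee <-; rewrite !mulrA ee -!mulrA ee.
Qed.

(** [g] and [e - g] add up to [e], and an invertible idempotent is the identity. *)
Lemma local_corner_idem e g :
  local_idem e -> g * g = g -> e * g * e = g -> g = e \/ g = 0.
Proof.
move=> [ee le] gg ege; have [eg ge] := cornerK ee ege.
have eg' : e * (e - g) * e = e - g by rewrite mulrBr mulrBl ee ee ege.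
have [] := le _ _ ege eg' (subrKC g e).
  by case=> c [cg _]; left; rewrite -eg -cg -mulrA gg.
case=> c [_ gc]; right.
by rewrite -ge -gc mulrA mulrBr ge gg subrr mul0r.
Qed.

(** If [c a = e] then [a c] is an idempotent of the corner, so it is [e] or [0]; in
    the latter case [e = (c a)(c a)] vanishes. *)
Lemma local_left_inverse e a d :
  local_idem e -> e * a * e = a -> d * a = e -> corner_unit e a.
Proof.
move=> le eae da; have [ee _] := le; have [ea ae] := cornerK ee eae.
pose c := e * d * e; have ca : c * a = e by rewrite -!mulrA ea da ee.
have ce : c * e = c by rewrite -mulrA ee.
exists c; split=> //.
have [//||//|ac0] := @local_corner_idem e (a * c) le.
- by rewrite -mulrA (mulrA c) ca mulrA ae.
- by rewrite mulrA ea -mulrA ce.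
have e0 : e = 0 by rewrite -ee -{1}ca -{1}ca mulrA -(mulrA c) ac0 mulr0 mul0r.
by rewrite ac0 e0.
Qed.

(** After multiplication by an inverse [c] of [a], this says that [e + c b] is
    invertible when [c b] is not; the equation [(e + c b) - c b = e] gives it. *)
Lemma local_unitD e a b :
  local_idem e -> e * a * e = a -> e * b * e = b ->
  corner_unit e a -> ~ corner_unit e b -> corner_unit e (a + b).
Proof.
move=> le eae ebe ua nub; have [ee lee] := le.
have [ea ae] := cornerK ee eae; have [eb be] := cornerK ee ebe.
case: ua => c0 [c0a ac0]; pose c := e * c0 * e.
have ca : c * a = e by rewrite -!mulrA ea c0a ee.
have [ec ce] : e * c = c /\ c * e = c by split; rewrite /c ?mulrA ?ee // -mulrA ee.
have [||||] := lee (c * (a + b)) (- (c * b)).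
- by rewrite mulrA ec -mulrA mulrDl ae be.
- by rewrite mulrN mulNr mulrA ec -mulrA be.
- by rewrite mulrDr ca addrK.
- move=> [d [dE _]]; apply: (@local_left_inverse _ _ (d * c)) => //.
    by rewrite mulrDr mulrDl ea eb ae be.
  by rewrite -mulrA.
move=> [d [dE _]]; case: nub; apply: (@local_left_inverse _ _ (- d * c)) => //.
by rewrite mulNr mulNr -mulrA -mulrN.
Qed.

(** Elements outside the unique maximal left ideal [I] have left inverses.  Such an
    inverse [c] of [a] lies outside [I] as well: otherwise [1 - a c] would be left
    invertible while annihilating [a]. *)
Lemma local_ring_idem : local_ring R -> local_idem 1.
Proof.
move=> [I [mI uI]]; have nI1 := maximal_proper mI.
have [[_ ID IM] _ _] := mI.
have linv a : ~ I a -> exists c, c * a = 1.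
  by have [//|[K mK Ka]] := left_inverse_or_maximal a; rewrite (uI _ mK).
have unitI a : ~ I a -> corner_unit 1 a.
  move=> nIa; have [c ca] := linv a nIa.
  exists c; split=> //.
  have [Ic|nIc] := pselect (I c); last first.
    have [d dc] := linv c nIc.
    suff -> : a = d by [].
    by rewrite -[LHS]mul1r -{1}dc -mulrA ca mulr1.
  have [|f fE] := linv (1 - a * c).
    by move=> Iac; apply: nI1; rewrite -(subrK (a * c) 1); apply: ID => //; apply: IM.
  case: nIa; suff -> : a = 0 by have [[]] := mI.
  by rewrite -[a]mul1r -{1}fE -mulrA mulrBl mul1r -mulrA ca mulr1 subrr mulr0.
split=> [|a b _ _ ab]; first exact: mul1r.
have [Ia|nIa] := pselect (I a); last by left; apply: unitI.
by right; apply: unitI => Ib; apply: nI1; rewrite -ab; apply: ID.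
Qed.

(** The component [s] of [1] along a complement is a right identity on [I]. *)
Lemma semisimple_generator I :
  semisimple_ring R -> left_ideal I -> exists s, I s /\ forall x, I x -> x * s = x.
Proof.
move=> ss lI; have [K [lK IK]] := ss _ lI.
move=> /(_ 1) [s [k [Is Kk E]]]; exists s; split=> // x Ix.
apply/eqP; rewrite -subr_eq0; apply/eqP; apply: IK.
  have [_ ID IM] := lI.
  by apply: ID; [apply: IM | apply: left_idealN].
have [_ _ KM] := lK.
rewrite (_ : _ - _ = - (x * k)); first by apply: left_idealN => //; apply: KM.
by rewrite -[in X in _ - X](mulr1 x) E mulrDr opprD addrA subrr sub0r.
Qed.

(** Left ideals of a semisimple ring satisfy the ascending chain condition: the
    union of a chain has a generator, which already lies in a member of the chain. *)
Lemma semisimple_maximal (F : set (set R)) :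
  semisimple_ring R -> (forall I, F I -> left_ideal I) -> (F !=set0)%classic ->
  exists2 I, F I & forall K, F K -> (I `<=` K)%classic -> K = I.
Proof.
move=> ss lF [I0 FI0].
pose P : set (set R) := [set A | A = set0 \/ F A]%classic.
have [|A [PA maxA]] := @Zorn_bigcup _ P.
  move=> G sGP totG.
  have [[A [GA A0]]|G0] := pselect (exists A, G A /\ A <> set0); last first.
    left; apply/seteqP; split=> // x [A GA Ax]; apply: G0; exists A.
    by split=> // A0; move: Ax; rewrite A0.
  have FG B : G B -> B <> set0 -> F B by move=> /sGP[].
  pose G' : set (set R) := [set A | G A /\ A <> set0]%classic.
  have -> : (\bigcup_(A in G) A = \bigcup_(A in G') A)%classic.
    apply/seteqP; split=> x [B GB Bx]; exists B => //; last by case: GB.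
    by split=> // B0; move: Bx; rewrite B0.
  have lU : left_ideal (\bigcup_(A in G') A)%classic.
    apply: left_ideal_bigcup; first by exists A.
      by move=> B [GB B0]; apply: lF; apply: FG.
    by move=> B B' [GB _] [GB' _]; apply: totG.
  have [s [[B [GB B0] Bs] sU]] := semisimple_generator ss lU.
  right; suff -> : (\bigcup_(A in G') A)%classic = B by apply: FG.
  apply/seteqP; split=> x; last by move=> Bx; exists B.
  have [_ _ BM] := lF _ (FG _ GB B0).
  by move=> /sU <-; apply: BM.
have FA : F A.
  case: PA => // A0; case: (maxA I0); last by right.
  rewrite A0 properEneq; split=> //; apply/eqP => E.
  by have [] := lF _ FI0; rewrite -E.
exists A => // K FK sAK; apply: contrapT => nKA.
case: (maxA K); last by right.
by rewrite properEneq; split=> //; apply/eqP => E; apply: nKA.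
Qed.
End LeftIdeals.

(** * Finite orthogonal sums of local idempotents *)

Lemma local_idem0 (R : pzRingType) : local_idem (0 : R).
Proof.
split=> [|a b <- _ _]; first exact: mulr0.
by left; exists 0; rewrite !mul0r.
Qed.

Lemma local_dec_sum (R : pzRingType) (I : eqType) (e : I -> R) (s : seq I) :
  uniq s -> (forall k, local_idem (e k)) ->
  (forall k l, k != l -> e k * e l = 0) ->
  local_dec (\sum_(k <- s) e k).
Proof.
move=> us loc orth; elim: s us => [_|k s IH /= /andP[ks us]].
  by rewrite big_nil; apply: Local_dec_one; apply: local_idem0.
have neq l : l \in s -> k != l by move=> ls; apply: contraNneq ks => ->.
rewrite big_cons; apply: Local_dec_add.
- by rewrite mulr_sumr big_seq big1 // => l /neq; apply: orth.
- by rewrite mulr_suml big_seq big1 // => l /neq; rewrite eq_sym; apply: orth.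
- exact: Local_dec_one.
exact: IH.
Qed.

Section Semiperfect.
Variable R : pzRingType.
Hypothesis sR : semiperfect_ring R.
Implicit Types (a b c e f g : R) (u : jacobson_quot R).

(** An idempotent lift [g] of [u] is moved into the corner [eRe].  As [g - g e g] is
    in the radical, [g e g] is invertible in [gRg], with inverse [w]; then [e w e] is
    an idempotent, and it reduces to [u] because [w] does. *)
Lemma idempotent_lift_below e u :
  e * e = e -> u * u = u -> jq e * u * jq e = u ->
  exists g, [/\ g * g = g, e * g * e = g & jq g = u].
Proof.
move=> ee uu eue; have [_ lift] := sR.
have jee : jq e * jq e = jq e by rewrite -rmorphM /= ee.
have [eu ue] := cornerK jee eue.
have [g [gg jg]] := lift u uu.
have jj : g - g * e * g \in @jacobson R.
  by apply/jq_eq0; rewrite raddfB /= !rmorphM /= jg ue uu subrr.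
have [w0 [w0l w0r]] := jacobson_inverse jj; move: w0l w0r.
set t := 1 - _ => w0t tw0.
have tg : t * g = g * e * g.
  by rewrite mulrBl mul1r mulrBl gg -!mulrA gg opprB addrC subrK.
have gt : g * t = g * e * g.
  by rewrite mulrBr mulr1 mulrBr gg !mulrA gg opprB addrC subrK.
have w0g : w0 * g = g * w0.
  by rewrite -[LHS]mulr1 -tw0 !mulrA -(mulrA w0) gt -tg mulrA w0t mul1r.
have jw0 : jq w0 = 1.
  have jt : jq t = 1 by rewrite /t raddfB /= ((jq_eq0 _).2 jj) subr0 rmorph1.
  by rewrite -[LHS]mulr1 -jt -rmorphM /= w0t rmorph1.
pose w := w0 * g.
have wgeg : w * e * w = w.
  have gw : g * w = w by rewrite /w w0g mulrA gg.
  have wg : w * g = w by rewrite /w -mulrA gg.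
  have wk : w * (g * e * g) = g by rewrite -tg mulrA -(mulrA w0) gt -tg mulrA w0t mul1r.
  by rewrite -{1}wg -{2}gw -mulrA -mulrA (mulrA e) (mulrA g) (mulrA g) mulrA wk.
have jw : jq w = u by rewrite rmorphM /= jw0 mul1r.
clearbody w; exists (e * w * e); split.
- by rewrite -!mulrA (mulrA e e) ee (mulrA e w e) (mulrA w (e * w)) (mulrA w e) wgeg mulrA.
- by rewrite -!mulrA ee !mulrA ee.
by rewrite !rmorphM /= jw.
Qed.

(** The left ideal generated by the class of [a] is generated by an idempotent,
    which lifts below [e].  Primitivity leaves only [0], when the class of [a]
    vanishes, and [e], when the class of [a] has a left inverse, which lifts. *)
Lemma primitive_left_inverse e a :
  e * e = e -> (forall g, g * g = g -> e * g * e = g -> g = e \/ g = 0) ->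
  e * a * e = a -> jq a = 0 \/ exists c, e * c * e = c /\ c * a = e.
Proof.
move=> ee prim eae; have [ea ae] := cornerK ee eae.
have [ja0|ja0] := pselect (jq a = 0); first by left.
right.
have [s0 [[r s0E] s0P]] :=
  semisimple_generator sR.1 (principal_left_ideal (jq a)).
have as0 : jq a * s0 = jq a by apply: s0P; exists 1; rewrite mul1r.
have s0e : s0 * jq e = s0 by rewrite s0E -mulrA -rmorphM /= ae.
have s0s0 : s0 * s0 = s0 by apply: s0P; exists r.
have jee : jq e * jq e = jq e by rewrite -rmorphM /= ee.
have [||g [gg ege gE]] := @idempotent_lift_below e (jq e * s0) ee.
- by rewrite mulrA -(mulrA _ s0) s0e -mulrA s0s0.
- by rewrite mulrA jee -mulrA s0e.
have [gEe|g0] := prim g gg ege; last first.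
  case: ja0; rewrite -as0 -{1}ae rmorphM /= -mulrA -gE g0 raddf0.
  by rewrite mulr0.
have [r' rE] := jq_surj r.
have jj : e - e * r' * a \in @jacobson R.
  by apply/jq_eq0; rewrite raddfB /= !rmorphM /= -rE -mulrA -s0E -gE gEe subrr.
have [w [wl _]] := jacobson_inverse jj.
exists (e * (w * e * r') * e); split; first by rewrite !mulrA ee -!mulrA ee.
rewrite -!mulrA ea.
suff -> : w * (e * (r' * a)) = e by rewrite ee.
transitivity (w * (1 - (e - e * r' * a)) * e); last by rewrite wl mul1r.
by rewrite -mulrA mulrBl mul1r mulrBl ee -!mulrA ae opprB addrC subrK.
Qed.

Lemma primitive_local e :
  e * e = e -> (forall g, g * g = g -> e * g * e = g -> g = e \/ g = 0) ->
  local_idem e.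
Proof.
move=> ee prim; split=> // a b eae ebe ab.
have [ea ae] := cornerK ee eae; have [eb be] := cornerK ee ebe.
have [/jq_eq0 Ja|[c [ece ca]]] := primitive_left_inverse ee prim eae.
  right; have [w [wl wr]] := jacobson_inverse Ja.
  have bE : b = e - a by rewrite -ab addrC addKr.
  have tb : (1 - a) * e = b by rewrite mulrBl mul1r ae.
  have bt : e * (1 - a) = b by rewrite mulrBr mulr1 ea.
  exists (e * w * e); split.
    by rewrite -!mulrA eb -tb (mulrA w) wl mul1r ee.
  by rewrite !mulrA be -bt -(mulrA e) wr mulr1 ee.
left; exists c; split; first exact: ca.
have [jc0|[d [ede dc]]] := primitive_left_inverse ee prim ece.
  have e0 : e = 0 by apply: jacobson_idempotent; rewrite // -ca rmorphM /= jc0 mul0r.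
  by rewrite -ece e0 !mul0r mulr0.
have [ec ce] := cornerK ee ece.
suff -> : a = d by [].
have [ed de] := cornerK ee ede.
by rewrite -ea -dc -mulrA ca.
Qed.

(** Noetherian induction: among the idempotents that violate the claim, one for
    which the left ideal of [1 - e] is maximal in the semisimple quotient is not
    primitive, since a primitive idempotent is local, and its two summands satisfy
    the claim by maximality. *)
Lemma semiperfect_local_dec e : e * e = e -> local_dec e.
Proof.
move=> ee; apply: contrapT => ne.
pose F : set (set (jacobson_quot R)) :=
  [set A | exists e, [/\ e * e = e, ~ local_dec e & A = principal (1 - jq e)]]%classic.
have [_ [f [ff nf ->]] maxf] : exists2 I, F I &
    forall K, F K -> (I `<=` K)%classic -> K = I.
  apply: semisimple_maximal sR.1 _ _; last by exists (principal (1 - jq e)), e.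
  by move=> _ [g [_ _ ->]]; apply: principal_left_ideal.
have sub g : g * g = g -> f * g * f = g -> g <> f -> local_dec g.
  move=> gg fgf gf; apply: contrapT => ng; apply: gf.
  have [fg g_f] := cornerK ff fgf.
  have E : principal (1 - jq g) = principal (1 - jq f).
    apply: maxf; first by exists g.
    move=> _ [r ->]; exists (r * (1 - jq f)); rewrite -mulrA; congr (_ * _).
    by rewrite mulrBr mulr1 mulrBl mul1r -rmorphM /= fg subrr subr0.
  have [r rE] : principal (1 - jq f) (1 - jq g) by rewrite -E; exists 1; rewrite mul1r.
  apply/eqP; rewrite eq_sym -subr_eq0; apply/eqP; apply: jacobson_idempotent.
    by rewrite mulrBl !mulrBr ff fg g_f gg subrr subr0.
  have -> : jq (f - g) = (1 - jq g) * jq (f - g).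
    by rewrite mulrBl mul1r -rmorphM /= mulrBr g_f gg subrr raddf0 subr0.
  rewrite rE -mulrA mulrBl mul1r -rmorphM /= mulrBr ff fg subrr.
  by rewrite mulr0.
apply: nf; have [prim|] := pselect (forall g, g * g = g -> f * g * f = g -> g = f \/ g = 0).
  by constructor; apply: primitive_local.
move=> /existsNP [g /not_implyP [gg /not_implyP [fgf /not_orP [gf g0]]]].
have [fg g_f] := cornerK ff fgf.
rewrite -(subrKC g f); apply: Local_dec_add.
- by rewrite mulrBr g_f gg subrr.
- by rewrite mulrBl fg gg subrr.
- exact: sub.
apply: sub.
- by rewrite mulrBl !mulrBr ff fg g_f gg subrr subr0.
- by rewrite mulrBr mulrBl ff fgf ff.
by move=> /(congr1 (fun x => f - x)); rewrite opprB addrC subrK subrr.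
Qed.
End Semiperfect.

Section DirectSums.
Variable C : hermitianCategory.
Implicit Types M N : C.

(** The corner ring of [i \oc p] is isomorphic to the endomorphism ring of [N], by
    [a ↦ p a i]. *)
Lemma retract_local_idem M N (i : hom N M) (p : hom M N) :
  p \oc i = idm N -> local_idem (1 : endo N) -> local_idem (i \oc p : endo M).
Proof.
move=> pi [_ loc]; split=> [|a b]; rewrite /GRing.mul /=.
  by rewrite compA -(compA i) pi compm1.
have corner (a' : hom M M) : i \oc p \oc a' \oc (i \oc p) = a' ->
    i \oc p \oc a' = a' /\ a' \oc i \oc p = a'.
  by move=> <-; rewrite !compA -(compA i p i) pi compm1 -!(compA _ p i) pi !compm1.
have unitP (a' : hom M M) : i \oc p \oc a' \oc (i \oc p) = a' ->
    corner_unit (1 : endo N) (p \oc a' \oc i) ->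
    corner_unit (i \oc p : endo M) a'.
  move=> /corner [ea ae] [c [ca ac]].
  move: ca ac; rewrite /GRing.mul /= => ca ac.
  exists (i \oc c \oc p); rewrite /GRing.mul /=; split.
    transitivity (i \oc (c \oc (p \oc a' \oc i)) \oc p).
      by rewrite -{1}ae !compA.
    by rewrite ca compm1.
  transitivity (i \oc ((p \oc a' \oc i) \oc c) \oc p).
    by rewrite -{1}ea !compA.
  by rewrite ac compm1.
move=> ea eb ab.
have [|||ua|ub] := loc (p \oc a \oc i) (p \oc b \oc i).
- by rewrite mul1r mulr1.
- by rewrite mul1r mulr1.
- by rewrite -compDl -compDr ab compA pi comp1m.
- by left; apply: unitP.
by right; apply: unitP.
Qed.

Lemma direct_sum_local_dec M n (N : 'I_n -> C) :
  (forall k, local_ring (endo (N k))) -> is_direct_sum M N ->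
  local_dec (1 : endo M).
Proof.
move=> loc [i [p [pi pi0 sum1]]].
have -> : (1 : endo M) = \sum_(k < n) (i k \oc p k : endo M) by rewrite sum1.
apply: local_dec_sum => [|k|k l kl]; first exact: index_enum_uniq.
  by apply: retract_local_idem (pi k) (local_ring_idem (loc k)).
rewrite /GRing.mul /= compA -(compA (i k)) pi0; last by rewrite eq_sym.
by rewrite compm0 comp0m.
Qed.

End DirectSums.

(** * Duality and forms on a fixed object *)

Section Duality.
Variable C : hermitianCategory.
Implicit Types M N : C.

Lemma dualm_inj M N (f g : hom M N) : dualm f = dualm g -> f = g.
Proof.
move=> fg; have [o [oK _]] := omega_iso N.
by rewrite -[f]comp1m -oK -compA omega_natural fg -omega_natural compA oK comp1m.
Qed.

(** [dualm (omega M)] is a one-sided inverse of an isomorphism. *)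
Lemma omega_dual_inv M : omega (dual M) \oc dualm (omega M) = idm (dual (dual (dual M))).
Proof.
have [o [oK Ko]] := omega_iso (dual M).
suff -> : dualm (omega M) = o by [].
by rewrite -[LHS]compm1 -Ko compA omega_dual comp1m.
Qed.

(** Together with [dualm_inj]: the duality is fully faithful, since its square is
    isomorphic to the identity. *)
Lemma dualm_surj M N (g : hom (dual N) (dual M)) :
  exists f : hom M N, dualm f = g.
Proof.
have [o [oK Ko]] := omega_iso N.
exists (o \oc dualm g \oc omega M); rewrite !dualm_comp.
transitivity (dualm (omega M) \oc (dualm (dualm g) \oc omega (dual N)) \oc
   dualm (omega N) \oc dualm o).
  by rewrite -!compA (compA (omega _)) omega_dual_inv comp1m.
by rewrite -omega_natural compA omega_dual comp1m -compA -dualm_comp oK dualm_id compm1.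
Qed.

(** For [g = f g e], an isomorphism between the summands of [M] and [N] that the
    idempotents [e] and [f] represent. *)
Definition corner_iso M N (e : hom M M) (f : hom N N) (g : hom M N) :=
  exists k : hom N M, k \oc g = e /\ g \oc k = f.

Lemma corner_iso_dual M N (e : hom M M) (f : hom N N) (g : hom M N) :
  corner_iso e f g -> corner_iso (dualm f) (dualm e) (dualm g).
Proof.
by move=> [k [kg gk]]; exists (dualm k); rewrite -!dualm_comp kg gk.
Qed.

(** The duality is an anti-isomorphism of endomorphism rings. *)
Lemma local_idem_dual M (e : endo M) :
  local_idem e -> local_idem (dualm e : endo (dual M)).
Proof.
move=> [ee loc]; rewrite /local_idem /GRing.mul /=; split.
  by rewrite -dualm_comp; congr dualm.
move=> a' b'; have [a <-] := dualm_surj a'; have [b <-] := dualm_surj b'.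
rewrite -!dualm_comp -dualmD => /dualm_inj ea /dualm_inj eb /dualm_inj ab.
have [||//|[c [ca ac]]|[c [cb bc]]] := loc a b.
- by rewrite /GRing.mul /= -compA.
- by rewrite /GRing.mul /= -compA.
- by left; apply: (@corner_iso_dual _ _ e e); exists c.
by right; apply: (@corner_iso_dual _ _ e e); exists c.
Qed.

Variable L : formParameter C.

Lemma epsK M N (f : hom M N) : f *~ eps L *~ eps L = f.
Proof. by rewrite -mulrzA; case: (epsP L) => ->. Qed.

Lemma compzl M N P (g : hom N P) (f : hom M N) :
  (g *~ eps L) \oc f = (g \oc f) *~ eps L.
Proof. by case: (epsP L) => ->; rewrite ?mulr1z // !mulrN1z compNm. Qed.

Lemma compzr M N P (g : hom N P) (f : hom M N) :
  g \oc (f *~ eps L) = (g \oc f) *~ eps L.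
Proof. by case: (epsP L) => ->; rewrite ?mulr1z // !mulrN1z compmN. Qed.

Lemma dualmz M N (f : hom M N) : dualm (f *~ eps L) = dualm f *~ eps L.
Proof. by case: (epsP L) => ->; rewrite ?mulr1z // !mulrN1z dualmN. Qed.

(** The hermitian transpose: the forms [h] with [flip h = h] are the
    [eps]-hermitian ones. *)
Definition flip M N (g : hom N (dual M)) : hom M (dual N) :=
  (dualm g \oc omega M) *~ eps L.

Lemma flip_hermitianization M (b : hom M (dual M)) :
  flip (hermitianization L b) = hermitianization L b.
Proof.
rewrite /flip /hermitianization dualmD dualmz dualm_comp compDl mulrzDl.
rewrite compzl epsK -compA -omega_natural compA omega_dual comp1m.
exact: addrC.
Qed.

Lemma corner_iso_flip M N (e : hom M M) (f : hom N N) (g : hom N (dual M)) :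
  corner_iso f (dualm e) g -> corner_iso e (dualm f) (flip g).
Proof.
move=> /corner_iso_dual [k [kg gk]]; have [o [oK Ko]] := omega_iso M.
exists ((o \oc k) *~ eps L); rewrite /flip !compzl !compzr; split.
  by rewrite epsK -compA (compA k) kg -omega_natural compA oK comp1m.
by rewrite -compA (compA (omega M)) Ko comp1m gk epsK.
Qed.

End Duality.

Section QuadraticForm.
Variables (C : hermitianCategory) (L : formParameter C).
Variables (V : C) (b : hom V (dual V)).
Implicit Types S T M N : C.

Definition polar S T (v : hom S V) (w : hom T V) : hom T (dual S) :=
  dualm v \oc hermitianization L b \oc w.

Definition qform T (v : hom T V) : hom T (dual T) := dualm v \oc b \oc v.

Lemma polarDl S T (v v' : hom S V) (w : hom T V) :
  polar (v + v') w = polar v w + polar v' w.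
Proof. by rewrite /polar dualmD !compDl. Qed.

Lemma polarDr S T (v : hom S V) (w w' : hom T V) :
  polar v (w + w') = polar v w + polar v w'.
Proof. by rewrite /polar compDr. Qed.

Lemma polarNr S T (v : hom S V) (w : hom T V) : polar v (- w) = - polar v w.
Proof. by rewrite /polar compmN. Qed.

Lemma polarNl S T (v : hom S V) (w : hom T V) : polar (- v) w = - polar v w.
Proof. by rewrite /polar dualmN !compNm. Qed.

Lemma polarMr S T T' (v : hom S V) (w : hom T V) (a : hom T' T) :
  polar v (w \oc a) = polar v w \oc a.
Proof. by rewrite /polar compA. Qed.

Lemma polarMl S S' T (v : hom S V) (w : hom T V) (a : hom S' S) :
  polar (v \oc a) w = dualm a \oc polar v w.
Proof. by rewrite /polar dualm_comp !compA. Qed.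

Lemma polar_flip S T (v : hom S V) (w : hom T V) :
  polar w v = flip L (polar v w).
Proof.
rewrite /polar /flip !dualm_comp -!compA -omega_natural (compA _ _ v).
rewrite -(compzr L) -(compzl L) (compA _ _ v) (compzl L) -/(flip L _).
by rewrite flip_hermitianization !compA.
Qed.

Lemma polar_eq0C S T (v : hom S V) (w : hom T V) : polar v w = 0 -> polar w v = 0.
Proof. by move=> E; rewrite polar_flip E /flip dualm0 comp0m mul0rz. Qed.

Lemma qformM S T (v : hom T V) (a : hom S T) :
  qform (v \oc a) = dualm a \oc qform v \oc a.
Proof. by rewrite /qform dualm_comp !compA. Qed.

(** Modulo [Lam] the cross terms are [polar v w], because [g] and [flip g] differ by
    an element of [Lam]. *)
Lemma qformD T (v w : hom T V) :
  qform (v + w) - (qform v + qform w + polar v w) \in Lam L T.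
Proof.
have := Lam_min L (dualm w \oc b \oc v).
rewrite !dualm_comp -!compA -omega_natural (compA _ _ w) -(compzr L) -(compzl L) => Lw.
rewrite (_ : _ - _ = dualm w \oc (b \oc v) -
  dualm v \oc ((dualm b \oc omega V) *~ eps L \oc w)) //.
rewrite /qform /polar /hermitianization dualmD !(compDl, compDr).
rewrite -!compA.
set A := dualm v \oc (b \oc v); set B := dualm w \oc (b \oc w).
set X := dualm v \oc (b \oc w); set Y := dualm w \oc (b \oc v).
set Z := dualm v \oc (_ \oc w).
by rewrite [X + B]addrC addrACA opprD (addrACA (A + B)) subrr add0r opprD addrA addrK.
Qed.

Lemma polar_isotropic T (v : hom T V) : qform v \in Lam L T -> polar v v = 0.
Proof.
move=> /Lam_max E; rewrite /polar /hermitianization compDr compDl -/(qform v).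
rewrite {1}E /qform !dualm_comp (compzr L) (compzl L).
by rewrite -!compA omega_natural addNr.
Qed.

End QuadraticForm.

(** * Exchanging hyperbolic pairs *)

Section Exchange.
Variables (C : hermitianCategory) (L : formParameter C).
Variables (V : C) (b : hom V (dual V)).
Implicit Types S T M N : C.
Local Notation H := (polar L b).
Local Notation q := (qform b).

(** A subobject of [V] seen through the morphisms that factor through it.  This
    gives orthogonal complements a meaning when kernels or images of idempotents
    do not exist. *)
Definition subfunctor := forall T : C, hom T V -> Prop.
Implicit Types K : subfunctor.

Definition submodule K :=
  (forall T (v w : hom T V), K T v -> K T w -> K T (v + w)) /\
  (forall S T (v : hom T V) (a : hom S T), K T v -> K S (v \oc a)).

Definition perp K M N (x : hom M V) (y : hom N V) : subfunctor :=
  fun T v => [/\ K T v, H x v = 0 & H y v = 0].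

(** Preservation of the polar form is stated besides that of the quadratic form, so
    that orthogonality is transported without recourse to polarization. *)
Definition isometric_subfunctors K K' :=
  exists phi psi : hom V V,
    [/\ forall T (v : hom T V), K T v -> K' T (phi \oc v) /\ psi \oc (phi \oc v) = v,
        forall T (v : hom T V), K' T v -> K T (psi \oc v) /\ phi \oc (psi \oc v) = v,
        forall T (v : hom T V), K T v -> q (phi \oc v) - q v \in Lam L T
      & forall S T (v : hom S V) (w : hom T V), K S v -> K T w ->
          H (phi \oc v) (phi \oc w) = H v w].

Lemma perp_submodule K M N (x : hom M V) (y : hom N V) :
  submodule K -> submodule (perp K x y).
Proof.
move=> [KD KM]; split=> [T v w [Kv xv yv] [Kw xw yw]|S T v a [Kv xv yv]].
  by split; [apply: KD | rewrite polarDr xv xw addr0 | rewrite polarDr yv yw addr0].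
by split; [apply: KM | rewrite polarMr xv comp0m | rewrite polarMr yv comp0m].
Qed.

Lemma perpC K M N (x : hom M V) (y : hom N V) : perp K x y = perp K y x.
Proof.
by apply: functional_extensionality_dep => T; apply/funext => v; apply/propext; split=> [] [].
Qed.

Lemma isometric_subfunctors_trans K1 K2 K3 :
  isometric_subfunctors K1 K2 -> isometric_subfunctors K2 K3 ->
  isometric_subfunctors K1 K3.
Proof.
move=> [f [f' [fK f'K fq fH]]] [g [g' [gK g'K gq gH]]].
exists (g \oc f), (f' \oc g'); split=> [T v Kv|T v Kv|T v Kv|S T v w Kv Kw].
- have [K2v E] := fK _ _ Kv; have [K3v E'] := gK _ _ K2v.
  by rewrite -!compA E' E.
- have [K2v E] := g'K _ _ Kv; have [K1v E'] := f'K _ _ K2v.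
  by rewrite -!compA E' E.
- have [K2v E] := fK _ _ Kv; rewrite -compA.
  rewrite -(subrK (q (f \oc v)) (q (g \oc _))) -addrA.
  by apply: rpredD; [apply: gq | apply: fq].
have [[K2v _] [K2w _]] := (fK _ _ Kv, fK _ _ Kw).
by rewrite -!compA gH // fH.
Qed.

Definition isotropic K M (e : hom M M) (x : hom M V) :=
  [/\ K M x, x \oc e = x & q x \in Lam L M].

(** A hyperbolic plane in [K] on the summand of [M] given by [e], with the second
    Lagrangian indexed by the summand of [N] given by [f] instead of by the dual of
    the first: this makes the notion symmetric in [x] and [y]. *)
Definition hyperbolic K M N (e : hom M M) (f : hom N N) (x : hom M V) (y : hom N V) :=
  [/\ isotropic K e x, isotropic K f y & corner_iso f (dualm e) (H x y)].

Lemma hyperbolicC K M N (e : hom M M) (f : hom N N) (x : hom M V) (y : hom N V) :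
  hyperbolic K e f x y -> hyperbolic K f e y x.
Proof.
by move=> [ix iy ixy]; split=> //; rewrite polar_flip; apply: corner_iso_flip.
Qed.

Lemma dual_absorb M (e : hom M M) (x : hom M V) T (v : hom T V) :
  x \oc e = x -> dualm e \oc H x v = H x v.
Proof. by move=> {2}<-; rewrite polarMl. Qed.

(** The Eichler-type map [v ↦ v - y l h(x, v)]. *)
Definition shear M N (y : hom N V) (l : hom (dual M) N) (x : hom M V) : hom V V :=
  idm V - y \oc (l \oc (dualm x \oc hermitianization L b)).

Lemma shearE M N (y : hom N V) (l : hom (dual M) N) (x : hom M V) T (v : hom T V) :
  shear y l x \oc v = v - y \oc (l \oc H x v).
Proof. by rewrite /shear compDl comp1m compNm -!compA /polar -compA. Qed.

(** On morphisms orthogonal to [y], adding a multiple of [y] changes no product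
    with [y].  The multiple is chosen to restore orthogonality to [x'], and the
    shear along [x] undoes it. *)
Lemma shear_perp K M M' N (e' : hom M' M') (f : hom N N)
    (x : hom M V) (x' : hom M' V) (y : hom N V)
    (k : hom (dual M) N) (k' : hom (dual M') N) T (v : hom T V) :
  submodule K -> isotropic K f y -> x' \oc e' = x' ->
  k \oc H x y = f -> H x' y \oc k' = dualm e' -> perp K x y v ->
  perp K x' y (shear y k' x' \oc v) /\
  shear y k x \oc (shear y k' x' \oc v) = v.
Proof.
move=> [KD KM] [Ky yf qy] x'e' kH Hk' [Kv xv yv].
have yy := polar_isotropic qy.
rewrite !shearE; split.
  split.
  - by apply: KD => //; rewrite -compmN; apply: KM.
  - by rewrite polarDr polarNr polarMr compA Hk' dual_absorb // subrr.
  - by rewrite polarDr polarNr polarMr yy comp0m yv subrr.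
rewrite polarDr xv add0r polarNr polarMr (compmN k) (compA k) kH !compmN opprK.
by rewrite (compA y f) yf subrK.
Qed.

(** Multiples of [y] are isotropic and orthogonal to the complement, so the shears
    are isometries there. *)
Lemma perp_exchange K M M' N (e : hom M M) (e' : hom M' M') (f : hom N N)
    (x : hom M V) (x' : hom M' V) (y : hom N V) :
  submodule K -> hyperbolic K e f x y -> hyperbolic K e' f x' y ->
  isometric_subfunctors (perp K x y) (perp K x' y).
Proof.
move=> sK [[_ xe _] iy [k [kH Hk]]] [[_ x'e' _] _ [k' [kH' Hk']]].
have [_ _ qy] := iy; have yy := polar_isotropic qy.
exists (shear y k' x'), (shear y k x); split=> [T v|T v|T v [_ _ yv]|S T v w].
- by move=> Kv; apply: shear_perp Kv; eauto.
- by move=> Kv; apply: shear_perp Kv; eauto.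
- rewrite shearE -compmN; set s := - _.
  rewrite -[X in X \in _](subrKA (q v + q (y \oc s) + H v (y \oc s))).
  apply: rpredD; first exact: qformD.
  rewrite polarMr (polar_eq0C yv) comp0m addr0 addrC addKr qformM.
  exact: Lam_pull.
move=> [_ _ yv] [_ _ yw]; rewrite !shearE.
rewrite polarDl !polarDr !polarNl !polarNr !polarMl !polarMr yy yw.
by rewrite (polar_eq0C yv) !(comp0m, compm0) !(oppr0, addr0).
Qed.

(** Modulo [Lam], the value at [z + y s] is [q z + H z y \oc s], which vanishes for
    [s = - (H z y)^-1 \oc q z]; the product with [y] is unaffected. *)
Lemma isotropic_correction K M N (e : hom M M) (f : hom N N)
    (z : hom M V) (y : hom N V) :
  submodule K -> K M z -> z \oc e = z -> isotropic K f y ->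
  corner_iso f (dualm e) (H z y) ->
  exists s : hom M N, hyperbolic K e f (z + y \oc s) y.
Proof.
move=> [KD KM] Kz ze iy [k [kH Hk]]; have [Ky yf qy] := iy.
have yy := polar_isotropic qy.
exists (- (k \oc q z)); split=> //; last first.
  by exists k; rewrite polarDl polarMl yy compm0 addr0.
split; first by apply: KD => //; apply: KM.
  by rewrite compDl ze -compA compNm -compA /qform -compA ze.
set s := - _.
rewrite -[X in X \in _](subrK (q z + q (y \oc s) + H z (y \oc s))).
apply: rpredD; first exact: qformD.
have qe : dualm e \oc q z = q z by rewrite /qform !compA -dualm_comp ze.
rewrite polarMr {2}/s compmN (compA (H z y)) Hk qe addrAC subrr add0r qformM.
exact: Lam_pull.
Qed.

(** Exchanges along [(x, y)], [(z, y)], [(z, y')], [(x', y')]. *)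
Lemma perp_link K M M' N N' R' (e : hom M M) (e' : hom M' M') (f : hom N N)
    (f' : hom N' N') (g : hom R' R')
    (x : hom M V) (y : hom N V) (x' : hom M' V) (y' : hom N' V) (z : hom R' V) :
  submodule K -> hyperbolic K e f x y -> hyperbolic K e' f' x' y' ->
  hyperbolic K g f z y -> hyperbolic K g f' z y' ->
  isometric_subfunctors (perp K x y) (perp K x' y').
Proof.
move=> sK hxy hxy' hzy hzy'.
apply: isometric_subfunctors_trans (perp_exchange sK hxy hzy) _.
apply: isometric_subfunctors_trans (perp_exchange sK hzy' hxy').
rewrite perpC [perp K z y']perpC.
by apply: perp_exchange sK (hyperbolicC hzy) (hyperbolicC hzy').
Qed.

(** Complements of hyperbolic pairs on the summand [e] do not depend on the pair.
    The ambient [K] varies, as needed to split off summands one at a time. *)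
Definition cancels M (e : hom M M) :=
  forall K (x x' : hom M V) (y y' : hom (dual M) V),
  submodule K ->
  isotropic K e x -> isotropic K (dualm e) y -> H x y = dualm e ->
  isotropic K e x' -> isotropic K (dualm e) y' -> H x' y' = dualm e ->
  isometric_subfunctors (perp K x y) (perp K x' y').

(** The chain from [(x, y)] to [(x', y')] passes through [x'], [x] or [y'] when
    [H x' y], [H x y'] or [H y y'] is invertible.  If none is, then
    [z = x + x' + y s], made isotropic by the choice of [s], has products with [y]
    and with [y'] that are sums of one invertible and otherwise non-invertible terms
    of a local corner ring. *)
Lemma local_cancels M (e : endo M) : local_idem e -> cancels e.
Proof.
move=> le K x x' y y' sK ix iy xy ix' iy' xy'.
have le1 := local_idem_dual le; have [ee1 _] := le1.
have le2 := local_idem_dual le1; have [ee2 _] := le2.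
rewrite /GRing.mul /= in ee1 ee2.
have ue : corner_iso (dualm e) (dualm e) (dualm e) by exists (dualm e).
have hxy : hyperbolic K e (dualm e) x y by split=> //; rewrite xy.
have hxy' : hyperbolic K e (dualm e) x' y' by split=> //; rewrite xy'.
have [u1|n1] := pselect (corner_iso (dualm e) (dualm e) (H x' y)).
  by apply: (@perp_link K _ _ _ _ _ e e (dualm e) (dualm e) e _ _ _ _ x') => //; split.
have [u2|n2] := pselect (corner_iso (dualm e) (dualm e) (H x y')).
  by apply: (@perp_link K _ _ _ _ _ e e (dualm e) (dualm e) e _ _ _ _ x) => //; split.
have [u3|n3] := pselect (corner_iso (dualm e) (dualm (dualm e)) (H y y')).
  have hyy : hyperbolic K (dualm e) (dualm e) y y' by split.
  rewrite (perpC K x' y').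
  by apply: (@perp_link K _ _ _ _ _ e (dualm e) (dualm e) e (dualm e) _ _ _ _ y') => //;
    apply: hyperbolicC.
have corner (z : hom M V) (w : hom (dual M) V) : z \oc e = z -> w \oc dualm e = w ->
    dualm e \oc H z w \oc dualm e = H z w.
  by move=> ze we; rewrite dual_absorb // -polarMr we.
have [_ xe _] := ix; have [_ xe' _] := ix'; have [_ ye _] := iy; have [_ ye' _] := iy'.
have us : corner_unit (dualm e : endo (dual M)) (H x y + H x' y).
  apply: local_unitD => //; [exact: corner | exact: corner | by rewrite xy].
have Kz : K M (x + x') by case: sK ix ix' => KD _ [Kx _ _] [Kx' _ _]; apply: KD.
have ze : (x + x') \oc e = x + x' by rewrite compDl xe xe'.
have [|s hz] := isotropic_correction sK Kz ze iy; first by rewrite polarDl.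
apply: (@perp_link K _ _ _ _ _ e e (dualm e) (dualm e) e _ _ _ _ (x + x' + y \oc s)) => //.
have [iz _ _] := hz; split=> //.
rewrite polarDl polarDl polarMl [H x y' + _]addrC.
have yse : y \oc s \oc e = y \oc s.
  by have [_ zse _] := iz; apply: (addrI (x + x')); rewrite -[RHS]zse compDl ze.
change (corner_unit (dualm e : endo (dual M)) (H x' y' + H x y' + dualm s \oc H y y')).
apply: local_unitD => //.
- by rewrite /GRing.mul /= compDr compDl !corner.
- by rewrite -polarMl; apply: corner.
- by apply: local_unitD => //; [exact: corner | exact: corner | rewrite xy'].
(* If [H (y \oc s) y'] were invertible, [H y y'] would have a left inverse [t]; the
   idempotent [H y y' \oc t] is then trivial, making [H y y'] invertible. *)
move=> [c [cB _]]; apply: n3.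
rewrite /GRing.mul /= in cB.
pose t := dualm e \oc c \oc dualm s \oc dualm (dualm e).
have tg : t \oc H y y' = dualm e.
  by rewrite /t -compA dual_absorb // -!compA cB ee1.
have gg : dualm (dualm e) \oc H y y' = H y y' by rewrite dual_absorb.
have te : t \oc dualm (dualm e) = t by rewrite /t -compA ee2.
have et : dualm e \oc t = t by rewrite /t !compA ee1.
clearbody t; exists t; split=> //.
have [||//|gt0] := @local_corner_idem _ _ (H y y' \oc t : endo (dual (dual M))) le2.
- by rewrite /GRing.mul /= -compA (compA t) tg et.
- by rewrite /GRing.mul /= compA gg -compA te.
have e0 : dualm e = 0.
  by rewrite -ee1 -{1}tg -{1}tg -compA (compA (H y y')) gt0 comp0m compm0.
by rewrite gt0 e0 dualm0.
Qed.

Lemma isometric_subfunctors_perp K K' M N (x : hom M V) (y : hom N V) (phi psi : hom V V) :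
  K M x -> K N y ->
  (forall T (v : hom T V), K T v -> K' T (phi \oc v) /\ psi \oc (phi \oc v) = v) ->
  (forall T (v : hom T V), K' T v -> K T (psi \oc v) /\ phi \oc (psi \oc v) = v) ->
  (forall T (v : hom T V), K T v -> q (phi \oc v) - q v \in Lam L T) ->
  (forall S T (v : hom S V) (w : hom T V), K S v -> K T w ->
          H (phi \oc v) (phi \oc w) = H v w) ->
  isometric_subfunctors (perp K x y) (perp K' (phi \oc x) (phi \oc y)).
Proof.
move=> Kx Ky phiK psiK phiq phiH; exists phi, psi; split=> [T v|T v|T v|S T v w].
- move=> [Kv xv yv]; have [K'v E] := phiK _ _ Kv; split=> //.
  by split=> //; rewrite phiH.
- move=> [Kv xv yv]; have [K'v E] := psiK _ _ Kv; split=> //.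
  by split=> //; rewrite -phiH // E.
- by move=> [Kv _ _]; apply: phiq.
by move=> [Kv _ _] [Kw _ _]; apply: phiH.
Qed.

Lemma isotropic_corner K M (e f : hom M M) (x : hom M V) :
  submodule K -> f \oc f = f -> isotropic K e x -> isotropic K f (x \oc f).
Proof.
move=> [_ KM] ff [Kx _ qx]; split; first exact: KM.
  by rewrite -compA ff.
by rewrite qformM; apply: Lam_pull.
Qed.

(** Restrict both pairs to [e].  The isometry between the two complements carries
    the part of the first pair on [f] to a pair in the complement of the second
    pair's part on [e], where [cancels f] applies. *)
Lemma cancels_add M (e f : hom M M) :
  e \oc e = e -> f \oc f = f -> e \oc f = 0 -> f \oc e = 0 ->
  cancels e -> cancels f -> cancels (e + f).
Proof.
move=> ee ff ef fe ce cf K x x' y y' sK ix iy xy ix' iy' xy'.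
have ee' : dualm e \oc dualm e = dualm e by rewrite -dualm_comp ee.
have ff' : dualm f \oc dualm f = dualm f by rewrite -dualm_comp ff.
have ef' : dualm e \oc dualm f = 0 by rewrite -dualm_comp fe dualm0.
have fe' : dualm f \oc dualm e = 0 by rewrite -dualm_comp ef dualm0.
have split_perp (z : hom M V) (w : hom (dual M) V) :
    isotropic K (e + f) z -> isotropic K (dualm (e + f)) w -> H z w = dualm (e + f) ->
    [/\ perp K z w = perp (perp K (z \oc e) (w \oc dualm e)) (z \oc f) (w \oc dualm f),
        H (z \oc e) (w \oc dualm e) = dualm e, H (z \oc f) (w \oc dualm f) = dualm f,
        perp K (z \oc e) (w \oc dualm e) (z \oc f) &
        perp K (z \oc e) (w \oc dualm e) (w \oc dualm f)].
  move=> [Kz ze qz] [Kw we qw] zw.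
  have Hij g h : H (z \oc g) (w \oc dualm h) = dualm g \oc (dualm e + dualm f) \oc dualm h.
    by rewrite polarMl polarMr zw dualmD compA.
  have zz := polar_isotropic qz; have ww := polar_isotropic qw.
  have [_ KM] := sK.
  split.
  - apply: functional_extensionality_dep => T; apply/funext => v; apply/propext.
    split=> [[Kv zv wv]|[[Kv zv wv] zv' wv']].
      by split; first split; rewrite ?polarMl ?zv ?wv ?compm0.
    split=> //.
      by rewrite -(dual_absorb _ ze) dualmD compDl -!polarMl zv zv' addr0.
    by rewrite -(dual_absorb _ we) dualmD dualmD compDl -!polarMl wv wv' addr0.
  - by rewrite Hij compDr compDl ee' ef' comp0m addr0 ee'.
  - by rewrite Hij compDr compDl fe' comp0m add0r ff' ff'.
  - split; first exact: KM.
      by rewrite polarMl polarMr zz comp0m compm0.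
    by apply: polar_eq0C; rewrite Hij compDr fe' ff' add0r fe'.
  split; first exact: KM.
    by rewrite Hij compDr ee' ef' addr0 ef'.
  by rewrite polarMl polarMr ww comp0m compm0.
have [-> Hxye Hxyf Kx Ky] := split_perp _ _ ix iy xy.
have [-> Hxye' Hxyf' Kx' Ky'] := split_perp _ _ ix' iy' xy'.
have [phi [psi [phiK psiK phiq phiH]]] := ce K _ _ _ _ sK
  (isotropic_corner sK ee ix) (isotropic_corner sK ee' iy) Hxye
  (isotropic_corner sK ee ix') (isotropic_corner sK ee' iy') Hxye'.
apply: isometric_subfunctors_trans (isometric_subfunctors_perp Kx Ky phiK psiK phiq phiH) _.
have [_ _ qx] := isotropic_corner sK ff ix; have [_ _ qy] := isotropic_corner sK ff' iy.
have [_ _ qx'] := isotropic_corner sK ff ix'; have [_ _ qy'] := isotropic_corner sK ff' iy'.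
apply: cf.
- exact: perp_submodule.
- split; [by have [] := phiK _ _ Kx | by rewrite -!compA ff |].
  by rewrite -(subrK (q (x \oc f)) (q _)); apply: rpredD => //; apply: phiq.
- split; [by have [] := phiK _ _ Ky | by rewrite -!compA ff' |].
  by rewrite -(subrK (q (y \oc dualm f)) (q _)); apply: rpredD => //; apply: phiq.
- by rewrite phiH.
- by split=> //; rewrite -compA ff.
- by split=> //; rewrite -compA ff'.
by [].
Qed.

Lemma local_dec_cancels M (e : endo M) : local_dec e -> cancels e.
Proof.
elim=> [{}e|{}e f ef fe de ce df cf]; first exact: local_cancels.
exact: cancels_add (local_dec_idem de) (local_dec_idem df) ef fe ce cf.
Qed.
End Exchange.

(** * Cancellation *)

Section Cancellation.
Variables (C : hermitianCategory) (L : formParameter C).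
Implicit Types S T M N P Q V : C.

Lemma biprod_eq T M N (v w : hom T (biprod M N)) :
  pr1 M N \oc v = pr1 M N \oc w -> pr2 M N \oc v = pr2 M N \oc w -> v = w.
Proof.
move=> E1 E2; rewrite -[v]comp1m -[w]comp1m -biprod_id !compDl -!compA.
by rewrite E1 E2.
Qed.

Lemma hermitianization_Lam M (b c : hom M (dual M)) :
  b - c \in Lam L M -> hermitianization L b = hermitianization L c.
Proof. by move=> /clsP /hermitianization_cls. Qed.

Lemma hermitianizationN M (b : hom M (dual M)) :
  hermitianization L (- b) = - hermitianization L b.
Proof. by rewrite /hermitianization dualmN compNm mulNrz opprD. Qed.

Lemma hermitianizationD M (b c : hom M (dual M)) :
  hermitianization L (b + c) = hermitianization L b + hermitianization L c.
Proof. by rewrite /hermitianization dualmD compDl mulrzDl addrACA. Qed.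

Lemma hermitianization_qform V (b : hom V (dual V)) T (v : hom T V) :
  hermitianization L (qform b v) = polar L b v v.
Proof.
rewrite /hermitianization /polar /qform !dualm_comp -!compA -omega_natural.
by rewrite !(compDr, compDl) !(compzl, compzr) !compA.
Qed.

Lemma qform_sum M N (b : hom M (dual M)) (c : hom N (dual N)) T (v : hom T (biprod M N)) :
  qform (form_sum b c) v = qform b (pr1 M N \oc v) + qform c (pr2 M N \oc v).
Proof. by rewrite /qform /form_sum compDr compDl !dualm_comp !compA. Qed.

Lemma hermitianization_sum M N (b : hom M (dual M)) (c : hom N (dual N)) :
  hermitianization L (form_sum b c) =
  form_sum (hermitianization L b) (hermitianization L c).
Proof.
have := hermitianization_qform (form_sum b c) (idm (biprod M N)).
rewrite /polar dualm_id comp1m compm1 => <-.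
by rewrite qform_sum !compm1 hermitianizationD !hermitianization_qform.
Qed.

Lemma polar_sum M N (b : hom M (dual M)) (c : hom N (dual N)) S T
    (v : hom S (biprod M N)) (w : hom T (biprod M N)) :
  polar L (form_sum b c) v w =
  polar L b (pr1 M N \oc v) (pr1 M N \oc w) + polar L c (pr2 M N \oc v) (pr2 M N \oc w).
Proof.
by rewrite /polar hermitianization_sum /form_sum compDr compDl !dualm_comp !compA.
Qed.

Definition full V : subfunctor V := fun _ _ => True.
Arguments full : clear implicits.

Lemma full_submodule V : submodule (full V).
Proof. by []. Qed.

(** [x = (i, 1)] is the graph of [i], isotropic because the forms on the two
    summands cancel.  Its partner comes from correcting [(i, 0)], whose product with
    [x] is the hermitian form of [p]. *)
Lemma hyperbolic_cover V (b : hom V (dual V)) P (p : hom P (dual P)) (i : hom P V) :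
  is_iso (hermitianization L p) -> qform b i - p \in Lam L P ->
  exists (x : hom P (biprod V P)) (y : hom (dual P) (biprod V P)),
  let B := form_sum b (- p) in
  [/\ isotropic L B (full _) (idm P) x,
      isotropic L B (full _) (dualm (idm P)) y,
      polar L B x y = dualm (idm P)
    & forall T (v : hom T (biprod V P)), perp L B (full _) x y v <->
        pr2 V P \oc v = 0 /\ polar L b i (pr1 V P \oc v) = 0].
Proof.
move=> [k [kh hk]] bip.
set B := form_sum b (- p).
pose z := in1 V P \oc i; pose x := z + in2 V P.
have ii : polar L b i i = hermitianization L p.
  by rewrite -hermitianization_qform; apply: hermitianization_Lam.
have z1 : pr1 V P \oc z = i by rewrite compA pr1_in1 comp1m.
have z2 : pr2 V P \oc z = 0 by rewrite compA pr2_in1 comp0m.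
have x1 : pr1 V P \oc x = i by rewrite compDr z1 pr1_in2 addr0.
have x2 : pr2 V P \oc x = idm P by rewrite compDr z2 pr2_in2 add0r.
have ix : isotropic L B (full _) (idm P) x.
  split=> //; first by rewrite compm1.
  by rewrite qform_sum x1 x2 {2}/qform dualm_id comp1m compm1.
have zv T (v : hom T _) : polar L B z v = polar L b i (pr1 V P \oc v).
  by rewrite polar_sum z1 z2 /polar dualm0 !comp0m addr0.
have zx : polar L B z x = hermitianization L p by rewrite zv x1.
have [||||s [iz _ _]] := @isotropic_correction _ L _ B (full _) _ _
  (idm P) (idm P) z x _ _ _ ix => //.
- by rewrite compm1.
- by rewrite zx dualm_id; exists k.
have [_ _ qz] := iz; have [_ _ qx] := ix.
have xz : polar L B x z = hermitianization L p.
  by rewrite polar_flip zx flip_hermitianization.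
have xx := polar_isotropic qx.
exists x, ((z + x \oc s) \oc k); split=> //.
- split=> //; first by rewrite dualm_id compm1.
  by rewrite qformM; apply: Lam_pull.
- by rewrite polarMr polarDr polarMr xx comp0m addr0 xz hk dualm_id.
move=> T v; have xv : polar L B x v =
    polar L b i (pr1 V P \oc v) - hermitianization L p \oc (pr2 V P \oc v).
  by rewrite polar_sum x1 x2 [X in _ + X]/polar dualm_id comp1m hermitianizationN compNm.
split=> [[_ xv0 yv0]|[v2 iv]].
  have zv0 : polar L B z v = 0.
    move: yv0; rewrite polarMl polarDl polarMl xv0 compm0 addr0.
    move=> /(congr1 (comp (dualm (hermitianization L p)))).
    by rewrite compA -dualm_comp kh dualm_id comp1m compm0.
  rewrite zv in zv0; split=> //.
  move: xv; rewrite xv0 zv0 sub0r => /esym/eqP; rewrite oppr_eq0 => /eqP /(congr1 (comp k)).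
  by rewrite compA kh comp1m compm0.
split=> //; first by rewrite xv iv v2 compm0 subrr.
by rewrite polarMl polarDl polarMl xv zv iv v2 compm0 subrr !(compm0, addr0).
Qed.

(** [P] is unimodular, so orthogonality to it inside [P ⟂ Q] means that the first
    component vanishes. *)
Lemma orthogonal_complement V (b : hom V (dual V)) P Q (p : hom P (dual P)) (c : hom Q (dual Q))
    (f : hom (biprod P Q) V) :
  is_iso (hermitianization L p) -> is_iso f ->
  qform b f - form_sum p c \in Lam L _ ->
  [/\ qform b (f \oc in1 P Q) - p \in Lam L P,
      qform b (f \oc in2 P Q) - c \in Lam L Q
    & exists r : hom V Q, r \oc (f \oc in2 P Q) = idm Q /\
      forall T (v : hom T V), polar L b (f \oc in1 P Q) v = 0 <->
        f \oc in2 P Q \oc (r \oc v) = v].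
Proof.
move=> [k [kh hk]] [g [gf fg]] bf.
have pull T (a : hom T (biprod P Q)) : qform b (f \oc a) - qform (form_sum p c) a \in Lam L T.
  rewrite qformM {2}/qform -compNm -compmN -compDl -compDr.
  exact: Lam_pull.
have polarf S T (v : hom S (biprod P Q)) (w : hom T (biprod P Q)) :
    polar L b (f \oc v) (f \oc w) = polar L (form_sum p c) v w.
  rewrite polarMl polarMr -hermitianization_qform (hermitianization_Lam bf).
  by rewrite /polar compA.
split.
- have := pull _ (in1 P Q); rewrite qform_sum pr1_in1 pr2_in1.
  by rewrite [qform c 0]/qform compm0 addr0 {2}/qform dualm_id comp1m compm1.
- have := pull _ (in2 P Q); rewrite qform_sum pr1_in2 pr2_in2.
  by rewrite [qform p 0]/qform compm0 add0r {2}/qform dualm_id comp1m compm1.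
exists (pr2 P Q \oc g); split.
  by rewrite -compA (compA g) gf comp1m pr2_in2.
move=> T v; have vE : v = f \oc (g \oc v) by rewrite compA fg comp1m.
rewrite {1}vE polarf polar_sum pr1_in1 pr2_in1.
rewrite [X in _ + X]/polar dualm0 !comp0m addr0 /polar dualm_id comp1m.
split=> [/(congr1 (comp k))|E].
  rewrite compA kh comp1m compm0 => v1.
  rewrite [RHS]vE -compA; congr (f \oc _); apply: biprod_eq.
    by rewrite compA pr1_in2 comp0m v1.
  by rewrite compA pr2_in2 comp1m compA.
by rewrite -E -!compA (compA g) gf comp1m (compA (pr1 _ _)) pr1_in2 comp0m compm0.
Qed.

(** Both orthogonal complements are pushed into [V ⟂ -P] as complements of
    hyperbolic pairs; an isometry between these families of morphisms into
    [V ⟂ -P] is read off on the two inclusions [k] and [k'], which represent them. *)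
Lemma unimodular_cancellation V (b : hom V (dual V)) P Q Q' (p : hom P (dual P))
    (c : hom Q (dual Q)) (c' : hom Q' (dual Q'))
    (f : hom (biprod P Q) V) (f' : hom (biprod P Q') V) :
  local_dec (1 : endo P) -> is_iso (hermitianization L p) ->
  is_iso f -> is_iso f' ->
  qform b f - form_sum p c \in Lam L _ ->
  qform b f' - form_sum p c' \in Lam L _ ->
  exists u : hom Q Q', is_iso u /\ qform c' u - c \in Lam L Q.
Proof.
move=> dec up ff ff' bf bf'.
have [bi bj [r [rj jr]]] := orthogonal_complement up ff bf.
have [bi' bj' [r' [rj' jr']]] := orthogonal_complement up ff' bf'.
have [x [y [ix iy xy xyP]]] := hyperbolic_cover up bi.
have [x' [y' [ix' iy' xy' xyP']]] := hyperbolic_cover up bi'.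
have [phi [psi [phiK psiK phiq _]]] :=
  local_dec_cancels dec (@full_submodule _) ix iy xy ix' iy' xy'.
set j := f \oc in2 P Q in bj rj jr; set j' := f' \oc in2 P Q' in bj' rj' jr'.
have image Q0 (i0 : hom P V) (j0 : hom Q0 V) (r0 : hom V Q0) :
    r0 \oc j0 = idm Q0 ->
    (forall T (v : hom T V), polar L b i0 v = 0 <-> j0 \oc (r0 \oc v) = v) ->
    forall T (v : hom T (biprod V P)),
      pr2 V P \oc v = 0 /\ polar L b i0 (pr1 V P \oc v) = 0 <->
      in1 V P \oc j0 \oc (r0 \oc pr1 V P \oc v) = v.
  move=> rj0 jr0 T v; split=> [[v2 /jr0 v1]|<-].
    apply: biprod_eq; last by rewrite !compA pr2_in1 !comp0m v2.
    by rewrite !compA pr1_in1 comp1m -!compA.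
  rewrite -!compA !(compA (pr1 V P) (in1 V P)) !(compA (pr2 V P)) pr1_in1 pr2_in1.
  rewrite !comp0m !comp1m; split=> //.
  by apply/jr0; rewrite (compA r0) rj0 comp1m.
pose k := in1 V P \oc j; pose k' := in1 V P \oc j'.
pose s := r \oc pr1 V P; pose s' := r' \oc pr1 V P.
have sk : s \oc k = idm Q by rewrite /s /k -compA (compA (pr1 V P)) pr1_in1 comp1m.
have sk' : s' \oc k' = idm Q' by rewrite /s' /k' -compA (compA (pr1 V P)) pr1_in1 comp1m.
have kP T (v : hom T (biprod V P)) := iff_trans (xyP T v) (image _ _ _ _ rj jr T v).
have kP' T (v : hom T (biprod V P)) := iff_trans (xyP' T v) (image _ _ _ _ rj' jr' T v).
rewrite -/k -/s in kP; rewrite -/k' -/s' in kP'.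
have kk : perp L (form_sum b (- p)) (full _) x y k by apply/kP; rewrite sk compm1.
have kk' : perp L (form_sum b (- p)) (full _) x' y' k' by apply/kP'; rewrite sk' compm1.
have [phik psiphi] := phiK _ _ kk; have [psik phipsi] := psiK _ _ kk'.
rewrite kP' in phik; rewrite kP in psik.
pose u := s' \oc (phi \oc k); pose u' := s \oc (psi \oc k').
have ku : k' \oc u = phi \oc k by [].
have ku' : k \oc u' = psi \oc k' by [].
have qk Q0 (j0 : hom Q0 V) : qform (form_sum b (- p)) (in1 V P \oc j0) = qform b j0.
  rewrite qform_sum !compA pr1_in1 pr2_in1 comp1m comp0m.
  by rewrite [X in _ + X]/qform compm0 addr0.
exists u; split.
  exists u'; split.
    by rewrite -[LHS]comp1m -sk -compA (compA k) ku' -(compA psi) ku psiphi.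
  by rewrite -[LHS]comp1m -sk' -compA (compA k') ku -(compA phi) ku' phipsi.
have := phiq _ _ kk; rewrite -ku qformM !qk => phiqk.
have E := Lam_pull u bj'.
rewrite compDr compDl compmN compNm in E.
have F := rpredB (rpredD phiqk bj) E.
by rewrite subrKA opprB addrC subrKA in F.
Qed.

End Cancellation.

Theorem corollary4p14 (C : hermitianCategory) (L : formParameter C)
    (hC : (forall M : C, exists (n : nat) (N : 'I_n -> C),
              (forall k : 'I_n, local_ring (endo (N k))) /\ is_direct_sum M N)
          \/ (forall M : C, semiperfect_ring (endo M)))
    (P Q1 Q2 : quadratic_space L) (hP : unimodular P)
    (hPQ : isometric (orth_sum P Q1) (orth_sum P Q2)) :
  isometric Q1 Q2.
Proof.
have dec : local_dec (1 : endo (qs_ob P)).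
  have [hloc|hsp] := hC; last exact: (semiperfect_local_dec (hsp _) (mulr1 _)).
  by have [n [N [locN sumN]]] := hloc (qs_ob P); apply: direct_sum_local_dec sumN.
have [f [isof]] := hPQ; rewrite /orth_sum /= pull_form_cls => /clsP fq.
have iso1 : is_iso (idm (biprod (qs_ob P) (qs_ob Q2))).
  by exists (idm _); rewrite comp1m.
have [|u [isou uq]] := unimodular_cancellation dec hP isof iso1 fq (c' := repr (qs_form Q2)).
  by rewrite /qform dualm_id comp1m compm1 subrr rpred0.
exists u; split=> //.
by rewrite -[qs_form Q2]cls_repr pull_form_cls -[RHS]cls_repr; apply/clsP.
Qed.
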